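(* Let $B\times F_1\times\cdots\times F_l$ be a degenerate multiply warped product with warping functions $f_1,\dots,f_l$, and let $X,Y,Z\in\Gamma(TB)$ and $U_j,V_j,W_j\in\Gamma(TF_j)$ (lifted), $1\le j\le l$. Let $\mathcal K$, $\mathcal K_B$, $\mathcal K_{F_j}$ be the Koszul forms of the multiply warped product, of $B$ and of $F_j$ (the last two lifted). Then: (1) $\mathcal K(X,Y,Z)=\mathcal K_B(X,Y,Z)$; (2) $\mathcal K(X,Y,W_j)=\mathcal K(X,W_j,Y)=\mathcal K(W_j,X,Y)=0$; (3) $\mathcal K(X,V_j,W_j)=\mathcal K(V_j,X,W_j)=-\mathcal K(V_j,W_j,X)=f_j\,g_{F_j}(V_j,W_j)\,X(f_j)$; (4) $\mathcal K(X,V_i,W_j)=\mathcal K(V_i,X,W_j)=\mathcal K(V_i,W_j,X)=0$ for $i\ne j$; (5) $\mathcal K(U_j,V_j,W_j)=f_j^2\,\mathcal K_{F_j}(U_j,V_j,W_j)$; (6) $\mathcal K(U_i,V_j,W_k)=0$ for $i,j,k$ pairwise different; (7) $\mathcal K(U_i,V_i,W_j)=\mathcal K(U_i,W_j,V_i)=\mathcal K(W_j,U_i,V_i)=0$ for $i\ne j$.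
   Context: A singular semi-Riemannian manifold is a smooth manifold with a smooth symmetric $(0,2)$-tensor field $g=\langle\cdot,\cdot\rangle$, possibly degenerate and of varying signature. Its Koszul form is $\mathcal K(X,Y,Z)=\tfrac12\{X\langle Y,Z\rangle+Y\langle Z,X\rangle-Z\langle X,Y\rangle-\langle X,[Y,Z]\rangle+\langle Y,[Z,X]\rangle+\langle Z,[X,Y]\rangle\}$. Let $(B,g_B)$ and $(F_j,g_{F_j})$, $1\le j\le l$, be singular semi-Riemannian manifolds and $f_j\in C^\infty(B)$ smooth functions (possibly with zeros). The (degenerate) multiply warped product is $B\times F_1\times\cdots\times F_l$ with the metric $\pi_B^*(g_B)+\sum_{j=1}^l(f_j\circ\pi_B)^2\pi_{F_j}^*(g_{F_j})$, where $\pi_B$, $\pi_{F_j}$ are the projections. Objects on the factors are identified with their lifts. *)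

(* Defs.v *)
From HB Require Import structures.
From mathcomp Require Import all_boot all_order all_algebra.
From mathcomp Require Import all_classical all_reals all_analysis.
From mathcomp Require Import ring.

Set Implicit Arguments.
Unset Strict Implicit.
Unset Printing Implicit Defensive.

Import Order.TTheory GRing.Theory Num.Theory.
Import numFieldNormedType.Exports.

Local Open Scope classical_set_scope.
Local Open Scope ring_scope.

Section Ck.
Context {R : realType}.

(* All iterated partial derivatives of f of order at most k exist and are
   continuous at the points of D; D is open in every use. *)
Fixpoint Ck n (k : nat) (D : set 'rV[R]_n) (f : 'rV[R]_n -> R) : Prop :=
  (forall x, D x -> {for x, continuous f}) /\
  if k is k'.+1 then
    forall i : 'I_n, (forall x, D x -> derivable f x 'e_i) /\
      Ck k' D ('D_'e_i f)
  else True.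

Definition Cinf n (D : set 'rV[R]_n) (f : 'rV[R]_n -> R) : Prop :=
  forall k, Ck k D f.

Lemma Ck_cont n k (D : set 'rV[R]_n) f :
  Ck k D f -> forall x, D x -> {for x, continuous f}.
Proof. by case: k => [|k] []. Qed.

Lemma Ck_pred n k (D : set 'rV[R]_n) f : Ck k.+1 D f -> Ck k D f.
Proof.
elim: k f => [|k IH] f [cf df]; first by split.
by split=> // i; have [dfi /IH] := df i.
Qed.

Lemma sub_Ck n k (D E : set 'rV[R]_n) f : D `<=` E -> Ck k E f -> Ck k D f.
Proof.
move=> DE; elim: k f => [|k IH] f [cf df]; split=> //.
- by move=> x /DE /cf.
- by move=> x /DE /cf.
- by move=> i; have [dfi /IH ?] := df i; split=> // x /DE /dfi.
Qed.

Let near_eq_continuous n (D : set 'rV[R]_n) (f g : 'rV[R]_n -> R) x :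
  open D -> D x -> (forall x, D x -> f x = g x) ->
  {for x, continuous f} -> {for x, continuous g}.
Proof.
move=> oD Dx fg cf; have nfg : {near x, f =1 g}.
  have : nbhs x D by exact: open_nbhs_nbhs.
  by apply: filterS => y; exact: fg.
have cfg : f @ x --> g x by rewrite -fg //; exact: cf.
exact: cvg_trans (near_eq_cvg nfg) cfg.
Qed.

Lemma eq_Ck n k (D : set 'rV[R]_n) f g :
  open D -> (forall x, D x -> f x = g x) -> Ck k D f -> Ck k D g.
Proof.
move=> oD; elim: k f g => [|k IH] f g fg [cf df].
  split=> // x Dx; exact: near_eq_continuous oD Dx fg (cf x Dx).
split=> [x Dx|i]; first exact: near_eq_continuous oD Dx fg (cf x Dx).
have nfg x : D x -> {near x, f =1 g}.
  move=> Dx; have nD : nbhs x D by exact: open_nbhs_nbhs.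
  by apply: filterS nD => y; exact: fg.
have [dfi Cfi] := df i; split=> [x Dx|].
  exact: near_eq_derivable (nfg x Dx) (dfi x Dx).
by apply: IH Cfi => x Dx; exact: near_eq_derive (nfg x Dx).
Qed.

Lemma Ck_cst n k (D : set 'rV[R]_n) (c : R) : Ck k D (fun=> c).
Proof.
elim: k c => [|k IH] c; split=> //.
- by move=> x _; exact: cst_continuous.
- by move=> x _; exact: cst_continuous.
move=> i; split=> [x _|]; first exact: derivable_cst.
rewrite (_ : 'D_ _ _ = fun=> 0); first exact: IH.
by apply/funext => x; rewrite derive_cst.
Qed.

Lemma CkD n k (D : set 'rV[R]_n) f g :
  open D -> Ck k D f -> Ck k D g -> Ck k D (fun x => f x + g x).
Proof.
move=> oD; elim: k f g => [|k IH] f g [cf df] [cg dg]; split=> //.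
- by move=> x Dx; exact: (continuousD (cf x Dx) (cg x Dx)).
- by move=> x Dx; exact: (continuousD (cf x Dx) (cg x Dx)).
move=> i; have [dfi Cfi] := df i; have [dgi Cgi] := dg i; split=> [x Dx|].
  by apply: derivableD; [exact: dfi|exact: dgi].
apply: eq_Ck (IH _ _ Cfi Cgi) => // x Dx.
by rewrite deriveD //; [exact: dfi|exact: dgi].
Qed.

Lemma CkM n k (D : set 'rV[R]_n) f g :
  open D -> Ck k D f -> Ck k D g -> Ck k D (fun x => f x * g x).
Proof.
move=> oD; elim: k f g => [|k IH] f g Cf Cg.
  case: Cf Cg => [cf _] [cg _]; split=> // x Dx.
  exact: (continuousM (cf x Dx) (cg x Dx)).
have [Cf' Cg'] := (Ck_pred Cf, Ck_pred Cg).
case: Cf Cg => [cf df] [cg dg]; split=> [x Dx|i].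
  exact: (continuousM (cf x Dx) (cg x Dx)).
have [dfi Cfi] := df i; have [dgi Cgi] := dg i; split=> [x Dx|].
  by apply: derivableM; [exact: dfi|exact: dgi].
apply: eq_Ck (CkD oD (IH _ _ Cf' Cgi) (IH _ _ Cg' Cfi)) => // x Dx.
by rewrite deriveM //; [exact: dfi|exact: dgi].
Qed.

(* Precomposition with the projection of R^n onto a family [s] of distinct
   coordinates. *)
Lemma Ck_coords n m k (D : set 'rV[R]_m) f (q : 'rV[R]_n -> 'rV[R]_m)
    (s : 'I_m -> 'I_n) :
  injective s -> (forall u j, q u 0 j = u 0 (s j)) -> continuous q ->
  open D -> Ck k D f -> Ck k (q @^-1` D) (f \o q).
Proof.
move=> sI qE cq oD.
have qD h v u : q (h *: v + u) = h *: q v + q u.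
  by apply/rowP => j; rewrite !(qE, mxE).
have oqD : open (q @^-1` D) by apply: open_comp.
elim: k f => [|k IH] f [cf df].
  by split=> // x Dx; apply: continuous_comp; [exact: cq|exact: cf].
split=> [x Dx|i]; first by apply: continuous_comp; [exact: cq|exact: cf].
have [[j sj]|nsi] := pselect (exists j, s j = i).
  have qd : q 'e_i = 'e_j.
    by apply/rowP => l; rewrite qE !mxE -sj (inj_eq sI).
  have growth x : (fun h => h^-1 *: (((f \o q) \o shift x)
      (h *: 'e_i) - (f \o q) x)) =
      (fun h => h^-1 *: ((f \o shift (q x)) (h *: 'e_j) - f (q x))).
    by apply/funext => h /=; rewrite qD qd.
  have [dfj Cfj] := df j; split=> [x Dx|].
    by rewrite /derivable growth; exact: (dfj (q x) Dx).
  apply: eq_Ck (IH _ Cfj) => // x Dx.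
  by rewrite /derive growth.
have qd : q 'e_i = 0.
  apply/rowP => l; rewrite qE !mxE; case: (s l =P i) => [sl|_].
    by case: nsi; exists l.
  by rewrite andbF.
have growth x : (fun h => h^-1 *: (((f \o q) \o shift x)
    (h *: 'e_i) - (f \o q) x)) = fun=> 0.
  by apply/funext => h /=; rewrite qD qd scaler0 add0r subrr scaler0.
split=> [x Dx|]; first by rewrite /derivable growth; exact: is_cvg_cst.
rewrite (_ : 'D_ _ _ = fun=> 0); first exact: Ck_cst.
by apply/funext => x; rewrite /derive growth lim_cst.
Qed.

End Ck.

Record chart (R : realType) (M : topologicalType) (n : nat) := Chart {
  chart_dom : set M;
  chart_cod : set 'rV[R]_n;
  chart_map : M -> 'rV[R]_n;
  (* the inverse of the chart; its values outside [chart_cod] are irrelevant *)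
  chart_inv : 'rV[R]_n -> M;
  chart_dom_open : open chart_dom;
  chart_cod_open : open chart_cod;
  chart_map_cod : forall p, chart_dom p -> chart_cod (chart_map p);
  chart_inv_dom : forall u, chart_cod u -> chart_dom (chart_inv u);
  chart_mapK : forall p, chart_dom p -> chart_inv (chart_map p) = p;
  chart_invK : forall u, chart_cod u -> chart_map (chart_inv u) = u;
  chart_map_continuous :
    forall p, chart_dom p -> {for p, continuous chart_map};
  chart_inv_continuous :
    forall u, chart_cod u -> {for u, continuous chart_inv} }.

(* Smooth manifolds: Hausdorff, second countable, of pure dimension, possibly
   empty. The smooth structure is given by an atlas that need not be maximal:
   all the notions below depend only on the maximal atlas it generates. *)
Record manifold (R : realType) := Manifold {
  manifold_space :> topologicalType;
  dim : nat;
  atlas : set (chart R manifold_space dim);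
  manifold_hausdorff : hausdorff_space manifold_space;
  manifold_second_countable : @second_countable manifold_space;
  atlas_cover : forall p, exists2 c, atlas c & chart_dom c p;
  atlas_compatible : forall c d, atlas c -> atlas d -> forall i : 'I_dim,
    Cinf [set u | chart_cod c u /\ chart_dom d (chart_inv c u)]
         (fun u => chart_map d (chart_inv c u) 0 i) }.

Section SmoothFunctions.
Context {R : realType} (M : manifold R).

Definition smooth : {pred (M -> R)} := fun f =>
  `[< forall c, @atlas R M c -> Cinf (chart_cod c) (f \o chart_inv c) >].

Lemma smoothP f : reflect
  (forall c, @atlas R M c -> Cinf (chart_cod c) (f \o chart_inv c))
  (f \in smooth).
Proof. exact: asboolP. Qed.

Lemma smooth_cst (a : R) : (fun=> a) \in smooth.
Proof. by apply/smoothP => c _ k; exact: Ck_cst. Qed.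

Lemma smooth_subring_closed : subring_closed smooth.
Proof.
have mul : {in smooth &, forall f g : M -> R, f * g \in smooth}.
  move=> f g /smoothP sf /smoothP sg; apply/smoothP => c Ac k.
  exact: (CkM (@chart_cod_open _ _ _ c) (sf c Ac k) (sg c Ac k)).
split=> //; first exact: smooth_cst.
move=> f g /smoothP sf /(mul _ _ (smooth_cst (- 1))) /smoothP sg.
apply/smoothP => c Ac k.
apply: (eq_Ck (@chart_cod_open _ _ _ c) _
  (CkD (@chart_cod_open _ _ _ c) (sf c Ac k) (sg c Ac k))) => u _ /=.
by rewrite -[RHS]/(f (chart_inv c u) - g (chart_inv c u)) -(mulN1r (g _)).
Qed.

Lemma smooth_scaler_closed : scaler_closed smooth.
Proof.
by move=> a f; case: smooth_subring_closed => _ _; apply; exact: smooth_cst.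
Qed.

HB.instance Definition _ :=
  GRing.isSubringClosed.Build (M -> R) smooth smooth_subring_closed.
HB.instance Definition _ :=
  GRing.isScaleClosed.Build R (M -> R) smooth smooth_scaler_closed.

Record smooth_fun := SmoothFun {
  smooth_fun_val :> M -> R;
  smooth_fun_smooth : smooth_fun_val \in smooth }.

HB.instance Definition _ := [isSub for smooth_fun_val].
HB.instance Definition _ := [Choice of smooth_fun by <:].
HB.instance Definition _ :=
  GRing.SubChoice_isSubComPzRing.Build _ _ smooth_fun (subringClosedP _).
HB.instance Definition _ := [SubZmodule_isSubLmodule of smooth_fun by <:].

End SmoothFunctions.
Arguments smooth {R} M.

(* Tangent vectors at p are the derivations at p of the algebra of smooth
   functions on M. *)
Section TangentSpace.
Context {R : realType} (M : manifold R) (p : M).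

Definition derivation_at : {pred (smooth_fun M -> R)} := fun v =>
  `[< scalar v /\
    forall f g : smooth_fun M, v (f * g) = v f * g p + f p * v g >].

Lemma derivation_atP v : reflect
  (scalar v /\
    forall f g : smooth_fun M, v (f * g) = v f * g p + f p * v g)
  (v \in derivation_at).
Proof. exact: asboolP. Qed.

Lemma derivation_at_submod_closed : submod_closed derivation_at.
Proof.
split; first apply/derivation_atP.
  by split=> [a f g|f g] /=; rewrite ?mulr0 ?mul0r addr0.
move=> a v w /derivation_atP[lv dv] /derivation_atP[lw dw].
apply/derivation_atP; split=> [b f g|f g].
  rewrite -![(a *: v + w) _]/(a * v _ + w _) lv lw /=.
  by rewrite !mulrDr addrACA; congr (_ + _ + _); rewrite mulrCA.
rewrite -![(a *: v + w) _]/(a * v _ + w _) dv dw /=.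
by rewrite !mulrDr !mulrDl addrACA mulrA (mulrCA a).
Qed.

HB.instance Definition _ := GRing.isSubmodClosed.Build R
  (smooth_fun M -> R) derivation_at derivation_at_submod_closed.

Record tangent := Tangent {
  tangent_val :> smooth_fun M -> R;
  tangent_derivation : tangent_val \in derivation_at }.

HB.instance Definition _ := [isSub for tangent_val].
HB.instance Definition _ := [Choice of tangent by <:].
HB.instance Definition _ := [SubChoice_isSubLmodule of tangent by <:].

End TangentSpace.

Section VectorFields.
Context {R : realType} (M : manifold R).

Record vector_field := VectorField {
  vector_at :> forall p : M, tangent p;
  vector_field_smooth : forall f, (fun p => vector_at p f) \in smooth M }.

Definition vf_app (X : vector_field) (f : smooth_fun M) : smooth_fun M :=
  SmoothFun (vector_field_smooth X f).

Fact bracket_subproof (X Y : vector_field) (p : M) :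
  (fun f => X p (vf_app Y f) - Y p (vf_app X f)) \in derivation_at p.
Proof.
have appL (Z : vector_field) : linear (vf_app Z).
  move=> a f g; apply/val_inj/funext => q /=.
  by have /derivation_atP[-> _] := tangent_derivation (Z q).
have appM (Z : vector_field) f g :
    vf_app Z (f * g) = vf_app Z f * g + f * vf_app Z g.
  apply/val_inj/funext => q /=.
  by have /derivation_atP[_ ->] := tangent_derivation (Z q).
have /derivation_atP[lX dX] := tangent_derivation (X p).
have /derivation_atP[lY dY] := tangent_derivation (Y p).
have addX f g : X p (f + g) = X p f + X p g.
  by have := lX 1 f g; rewrite scale1r mul1r.
have addY f g : Y p (f + g) = Y p f + Y p g.
  by have := lY 1 f g; rewrite scale1r mul1r.
apply/derivation_atP; split=> [a f g|f g] /=.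
  by rewrite !appL lX lY mulrBr opprD addrACA.
by rewrite !appM addX addY !dX !dY /=; ring.
Qed.

Definition bracket_at X Y p : tangent p := Tangent (bracket_subproof X Y p).

Fact bracket_smooth X Y f : (fun p => bracket_at X Y p f) \in smooth M.
Proof.
exact: (rpredB (smooth_fun_smooth (vf_app X (vf_app Y f)))
               (smooth_fun_smooth (vf_app Y (vf_app X f)))).
Qed.

Definition bracket X Y : vector_field := VectorField (bracket_smooth X Y).

End VectorFields.


Section Metric.
Context {R : realType}.

Record singular_metric (M : manifold R) := SingularMetric {
  metric_form :> forall p : M, {biscalar (tangent p)};
  metric_sym : forall p v w, metric_form p v w = metric_form p w v;
  metric_smooth : forall X Y : vector_field M,
    (fun p => metric_form p (X p) (Y p)) \in smooth M }.

Section Koszul.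
Variable M : manifold R.

(* X(h), extended by 0 to functions h that are not smooth, so that [koszul]
   makes sense for an arbitrary field g of bilinear forms. When g is a singular
   metric all the functions [inner X Y] are smooth and the convention plays no
   role. *)
Definition vf_derive (X : vector_field M) (h : M -> R) : M -> R :=
  fun p => oapp (X p) 0 (insub h).

Variable g : forall p : M, {biscalar (tangent p)}.

Definition inner (X Y : vector_field M) : M -> R := fun p => g p (X p) (Y p).

Definition koszul (X Y Z : vector_field M) : M -> R := fun p =>
  2^-1 * (vf_derive X (inner Y Z) p + vf_derive Y (inner Z X) p
          - vf_derive Z (inner X Y) p
          - inner X (bracket Y Z) p + inner Y (bracket Z X) p
          + inner Z (bracket X Y) p).

End Koszul.

(* Tangent vectors act on globally defined smooth functions, so the differential
   of phi only requires that composition with phi preserves smoothness. *)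
Section Differential.
Variables (M N : manifold R) (phi : M -> N).
Hypothesis phi_smooth : forall f, f \in smooth N -> f \o phi \in smooth M.

Definition pullback (f : smooth_fun N) : smooth_fun M :=
  SmoothFun (phi_smooth (smooth_fun_smooth f)).

Fact differential_subproof p (v : tangent p) :
  v \o pullback \in derivation_at (phi p).
Proof.
have /derivation_atP[lv dv] := tangent_derivation v.
have pullL : linear pullback by move=> a f g; exact/val_inj.
have pullM f g : pullback (f * g) = pullback f * pullback g by exact/val_inj.
apply/derivation_atP; split=> [a f g|f g] /=; first by rewrite pullL lv.
by rewrite pullM dv.
Qed.

Definition differential p (v : tangent p) : tangent (phi p) :=
  Tangent (differential_subproof v).

Fact differential_is_linear p : linear (@differential p).
Proof. by move=> a v w; apply/val_inj/funext. Qed.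

HB.instance Definition _ p := GRing.isLinear.Build R
  (tangent p) (tangent (phi p)) _ (@differential p) (@differential_is_linear p).

End Differential.
End Metric.

Section ProductTopology.

Lemma nbhs_prodP l (T : 'I_l -> topologicalType) (x : prod_topology T) A :
  nbhs x A <-> exists2 P : forall j, set (T j), forall j, nbhs (x j) (P j) &
    [set y : prod_topology T | forall j, P j (y j)] `<=` A.
Proof.
split=> [|[P nP PA]].
  pose G : set_system (prod_topology T) := filter_from
    [set P : forall j, set (T j) | forall j, nbhs (x j) (P j)]
    (fun P => [set y | forall j, P j (y j)]).
  have FG : Filter G.
    apply: filter_from_filter => [|P Q nP nQ].
      by exists (fun=> setT) => j; exact: filterT.
    exists (fun j => P j `&` Q j) => [j|y PQy]; first exact: filterI.
    by split=> j; have [] := PQy j.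
  have : G --> x.
    apply/cvg_sup => i B.
    rewrite nbhsE => -[C [[D oD <-] Dx] CB].
    exists (fun j y => forall e : i = j, D (ecast i (T i) (esym e) y)).
      move=> j; have [e|ne] := eqVneq i j.
        case: _ / e.
        have : nbhs (x i) D by exact: open_nbhs_nbhs.
        by apply: filterS => y Dy e; rewrite (eq_irrelevance e erefl).
      by apply: filterS filterT => y _ e; rewrite e eqxx in ne.
    by move=> y /(_ i erefl) /CB.
  by move=> Gx /Gx [P nP PA]; exists P.
apply: filterS PA _.
have : forall j, nbhs x [set y : prod_topology T | P j (y j)].
  by move=> j; exact: (@proj_continuous _ T j x _ (nP j)).
by move=> /filter_forall.
Qed.

Lemma continuous_prod l (S : topologicalType) (T : 'I_l -> topologicalType)
    (f : S -> prod_topology T) x :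
  (forall j, {for x, continuous (fun y => f y j)}) -> {for x, continuous f}.
Proof.
move=> cf A /nbhs_prodP[P nP PA]; apply: filterS (fun y => PA (f y)) _.
by apply: filter_forall => j; exact: cf (nP j).
Qed.

Lemma continuous_row (R : realType) n (S : topologicalType)
    (f : S -> 'rV[R]_n) x :
  (forall i, {for x, continuous (fun y => f y 0 i)}) -> {for x, continuous f}.
Proof.
move=> cf A [P nP PA]; apply: filterS (fun y => PA (f y)) _.
apply: filter_forall => i; apply: filter_forall => j.
by have := nP i j; rewrite (ord1 i); exact: (cf j).
Qed.

Lemma second_countable_prod l (S : topologicalType)
    (T : 'I_l -> topologicalType) :
  @second_countable S -> (forall j, @second_countable (T j)) ->
  @second_countable (S * prod_topology T)%type.
Proof.
have enum (X : Type) (A : set (set X)) : countable A ->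
    exists e : nat -> set X, forall U, A U -> exists i, e i = U.
  move=> /countable_injP[f fI].
  exists (fun i => xget set0 [set U | A U /\ f U = i]) => U AU.
  exists (f U); case: xgetP => [V _ [AV fVU]|/(_ U)[]//].
  by apply: fI; rewrite ?inE.
move=> [b cb [bo bn]] sT.
pose P j (b : set (set (T j))) := countable b /\ basis b.
have exP j : exists b, P j b by have [b' cb' bb'] := sT j; exists b'.
pose bT j := projT1 (cid (exP j)).
have PT j : P j (bT j) by exact: projT2 (cid (exP j)).
pose box (U : set S) (V : forall j, set (T j)) :=
  [set x : S * prod_topology T | U x.1 /\ forall j, V j (x.2 j)].
exists [set W | exists U V, [/\ b U, forall j, bT j (V j) & W = box U V]].
  have [e eP] := enum _ _ cb.
  pose eT j := projT1 (cid (enum _ _ (PT j).1)).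
  have eTP j : forall U, bT j U -> exists i, eT j i = U.
    exact: projT2 (cid (enum _ _ (PT j).1)).
  apply: (@sub_countable _ _ _ (range (fun p : nat * {ffun 'I_l -> nat} =>
    box (e p.1) (fun j => eT j (p.2 j))))).
    apply: subset_card_le => _ [U [V [bU bV ->]]].
    have [i <-] := eP _ bU.
    have /choice[h hP] : forall j, exists i, eT j i = V j.
      by move=> j; exact: eTP.
    exists (i, [ffun j => h j]) => //=; congr box.
    by apply: functional_extensionality_dep => j; rewrite ffunE hP.
  exact: card_le_trans (card_image_le _ _) (countableP _).
split.
  move=> _ [U [V [bU bV ->]]]; rewrite openE => x [Ux Vx].
  have n1 : nbhs x [set y : S * prod_topology T | U y.1].
    have : nbhs x.1 U by apply: open_nbhs_nbhs; split=> //; exact: bo.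
    exact: cvg_fst.
  have n2 : nbhs x [set y : S * prod_topology T | forall j, V j (y.2 j)].
    have : nbhs x.2 [set y : prod_topology T | forall j, V j (y j)].
      apply/nbhs_prodP; exists V => // j.
      by apply: open_nbhs_nbhs; split=> //; have [_ [bo' _]] := PT j; exact: bo'.
    exact: cvg_snd.
  exact: filterI n1 n2.
move=> x A [[U V] /= [nU /nbhs_prodP[Q nQ QV]] UVA].
have [U' [bU' U'x] U'U] := bn _ _ nU.
have exV' j : exists V', [/\ bT j V', V' (x.2 j) & V' `<=` Q j].
  have [_ [_ bn']] := PT j.
  by have [V' [? ?] ?] := bn' _ _ (nQ j); exists V'.
pose V' j := projT1 (cid (exV' j)).
have V'P j : [/\ bT j (V' j), V' j (x.2 j) & V' j `<=` Q j].
  exact: projT2 (cid (exV' j)).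
exists (box U' V').
  split; first by exists U', V'; split=> // j; have [] := V'P j.
  by split=> // j; have [] := V'P j.
move=> y [U'y V'y]; apply: UVA; split; first exact: U'U.
by apply: QV => j; have [_ _] := V'P j; apply; exact: V'y.
Qed.

Lemma hausdorff_prod l (S : topologicalType) (T : 'I_l -> topologicalType) :
  hausdorff_space S -> (forall j, hausdorff_space (T j)) ->
  hausdorff_space (S * prod_topology T)%type.
Proof.
move=> hS hT [s t] [s' t'] clst; congr (_, _).
  apply: hS => A B nA nB.
  have [[u v] /= [Au Bu]] := clst (fst @^-1` A) (fst @^-1` B)
    (cvg_fst nA) (cvg_fst nB).
  by exists u.
apply: (hausdorff_product hT) => A B nA nB.
have [[u v] /= [Av Bv]] := clst (snd @^-1` A) (snd @^-1` B)
  (cvg_snd nA) (cvg_snd nB).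
by exists v.
Qed.

Lemma continuous_lsubmx_row (R : realType) n m :
  continuous (lsubmx : 'rV[R]_(n + m) -> 'rV[R]_n).
Proof.
move=> u; apply: continuous_row => i.
rewrite (_ : (fun _ => _) = (fun u : 'rV[R]_(n + m) => u 0 (lshift m i))).
  exact: coord_continuous.
by apply/funext => v; rewrite mxE.
Qed.

Lemma continuous_submxrow_rsubmx (R : realType) n l (m : 'I_l -> nat) j :
  continuous (fun u : 'rV[R]_(n + \sum_j m j) => submxrow (rsubmx u) j).
Proof.
move=> u; apply: continuous_row => i.
rewrite (_ : (fun _ => _) = (fun u : 'rV[R]_(n + \sum_j m j) =>
    u 0 (rshift n (tagnat.Rank j i)))).
  exact: coord_continuous.
by apply/funext => v; rewrite !mxE.
Qed.

End ProductTopology.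

Section ProductChart.
Context {R : realType} (S : topologicalType) (l : nat).
Variables (T : 'I_l -> topologicalType) (n : nat) (m : 'I_l -> nat).
Variables (c : chart R S n) (d : forall j, chart R (T j) (m j)).

Let N := (n + \sum_j m j)%N.

Let dom : set (S * prod_topology T) :=
  [set x | chart_dom c x.1 /\ forall j, chart_dom (d j) (x.2 j)].

Let cod : set 'rV[R]_N :=
  [set u | chart_cod c (lsubmx u) /\
     forall j, chart_cod (d j) (submxrow (rsubmx u) j)].

Let map (x : S * prod_topology T) : 'rV[R]_N :=
  row_mx (chart_map c x.1) (\mxrow_j chart_map (d j) (x.2 j)).

Let inv (u : 'rV[R]_N) : S * prod_topology T :=
  (chart_inv c (lsubmx u),
   fun j => chart_inv (d j) (submxrow (rsubmx u) j)).

Let continuous_proj j :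
  continuous (fun x : S * prod_topology T => x.2 j).
Proof.
move=> x; apply: (@continuous_comp _ _ _ snd (fun y : prod_topology T => y j)).
  exact: cvg_snd.
exact: (@proj_continuous _ T j).
Qed.

Let dom_open : open dom.
Proof.
rewrite openE => x [dx1 dx2].
have n1 : nbhs x [set y : S * prod_topology T | chart_dom c y.1].
  have : nbhs x.1 (chart_dom c).
    by apply: open_nbhs_nbhs; split=> //; exact: chart_dom_open.
  exact: cvg_fst.
have n2 j : nbhs x [set y : S * prod_topology T | chart_dom (d j) (y.2 j)].
  apply: continuous_proj.
  by apply: open_nbhs_nbhs; split=> //; exact: chart_dom_open.
exact: filterI n1 (filter_forall _ n2).
Qed.

Let cod_open : open cod.
Proof.
rewrite openE => u [du1 du2].
have n1 : nbhs u [set v : 'rV[R]_N | chart_cod c (lsubmx v)].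
  apply: continuous_lsubmx_row.
  by apply: open_nbhs_nbhs; split=> //; exact: chart_cod_open.
have n2 j :
    nbhs u [set v : 'rV[R]_N | chart_cod (d j) (submxrow (rsubmx v) j)].
  apply: continuous_submxrow_rsubmx.
  by apply: open_nbhs_nbhs; split=> //; exact: chart_cod_open.
exact: filterI n1 (filter_forall _ n2).
Qed.

Let map_cod x : dom x -> cod (map x).
Proof.
move=> [dx1 dx2]; rewrite /cod /map /= row_mxKl row_mxKr; split.
  exact: chart_map_cod.
by move=> j; rewrite mxrowK; exact: chart_map_cod.
Qed.

Let inv_dom u : cod u -> dom (inv u).
Proof.
by move=> [du1 du2]; split=> [|j] /=; apply: chart_inv_dom.
Qed.

Let mapK x : dom x -> inv (map x) = x.
Proof.
case: x => x1 x2 [dx1 dx2]; rewrite /inv /map /= row_mxKl row_mxKr.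
rewrite chart_mapK //; congr (_, _); apply: functional_extensionality_dep => j.
by rewrite mxrowK chart_mapK //; exact: dx2.
Qed.

Let invK u : cod u -> map (inv u) = u.
Proof.
move=> [du1 du2]; rewrite /map /inv /= chart_invK //.
rewrite -[RHS]hsubmxK; congr row_mx; rewrite -[RHS]submxrowK.
by apply: eq_mxrow => j; rewrite chart_invK.
Qed.

Let map_continuous x : dom x -> {for x, continuous map}.
Proof.
move=> [dx1 dx2]; apply: continuous_row => i; rewrite /map.
case: (split_ordP i) => k ->.
  rewrite (_ : (fun _ => _) =
      (fun u : 'rV_n => u 0 k) \o (chart_map c \o fst)); last first.
    by apply/funext => y; rewrite row_mxEl.
  apply: continuous_comp; last exact: coord_continuous.
  by apply: continuous_comp; [exact: cvg_fst|exact: chart_map_continuous].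
rewrite (_ : (fun _ => _) =
    (fun u : 'rV[R]_(m (tagnat.sig1 k)) => u 0 (tagnat.sig2 k)) \o
    (chart_map (d (tagnat.sig1 k)) \o
     (fun y : S * prod_topology T => y.2 (tagnat.sig1 k)))); last first.
  by apply/funext => y; rewrite row_mxEr mxE.
apply: continuous_comp; last exact: coord_continuous.
by apply: continuous_comp; [exact: continuous_proj|exact: chart_map_continuous].
Qed.

Let inv_continuous u : cod u -> {for u, continuous inv}.
Proof.
move=> [du1 du2].
have c1 : {for u, continuous (chart_inv c \o lsubmx)}.
  apply: continuous_comp; first exact: continuous_lsubmx_row.
  exact: chart_inv_continuous.
have c2 : {for u, continuous (fun v : 'rV[R]_N =>
    (fun j => chart_inv (d j) (submxrow (rsubmx v) j)) : prod_topology T)}.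
  apply: continuous_prod => j.
  apply: (@continuous_comp _ _ _ (fun v : 'rV[R]_N => submxrow (rsubmx v) j)
    (chart_inv (d j))); first exact: continuous_submxrow_rsubmx.
  exact: chart_inv_continuous.
exact: cvg_pair c1 c2.
Qed.

Definition prod_chart : chart R (S * prod_topology T)%type N :=
  Chart dom_open cod_open map_cod inv_dom mapK invK
    map_continuous inv_continuous.

End ProductChart.

Section ProductManifold.
Context {R : realType} {l : nat}.
Variables (B : manifold R) (F : 'I_l -> manifold R).

Let space := (B * prod_topology (fun j => manifold_space (F j)))%type.

Definition prod_atlas : set (chart R space (dim B + \sum_j dim (F j))) :=
  [set e | exists c d, [/\ @atlas R B c, forall j, @atlas R (F j) (d j)
                         & e = prod_chart c d]].

Fact prod_atlas_cover (x : space) :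
  exists2 e, prod_atlas e & chart_dom e x.
Proof.
have [c Ac cx] := @atlas_cover R B x.1.
pose P j (d : chart R (F j) (dim (F j))) := atlas d /\ chart_dom d (x.2 j).
have exd j : exists d, P j d.
  by have [d Ad dx] := @atlas_cover R (F j) (x.2 j); exists d.
pose d j := projT1 (cid (exd j)).
have Pd j : P j (d j) by exact: projT2 (cid (exd j)).
exists (prod_chart c d); last by split=> // j; have [] := Pd j.
by exists c, d; split=> // j; have [] := Pd j.
Qed.

Let Cinf_lsub n m (D : set 'rV[R]_n) f : open D -> Cinf D f ->
  Cinf [set u : 'rV[R]_(n + m) | D (lsubmx u)] (fun u => f (lsubmx u)).
Proof.
move=> oD Df k.
apply: (@Ck_coords _ _ _ _ _ _ _ (lshift m) _ _ _ oD (Df k)).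
- exact: lshift_inj.
- by move=> u j; rewrite mxE.
- exact: continuous_lsubmx_row.
Qed.

Let Cinf_rsub n (m : 'I_l -> nat) j (D : set 'rV[R]_(m j)) f :
  open D -> Cinf D f ->
  Cinf [set u : 'rV[R]_(n + \sum_j m j) | D (submxrow (rsubmx u) j)]
       (fun u => f (submxrow (rsubmx u) j)).
Proof.
move=> oD Df k.
apply: (@Ck_coords _ _ _ _ _ _ (fun u => submxrow (rsubmx u) j)
  (fun i => rshift n (tagnat.Rank j i)) _ _ _ oD (Df k)).
- move=> i1 i2 /rshift_inj /(congr1 val) /= /eqP.
  by rewrite tagnat.eq_Rank eqxx /= => /eqP /val_inj.
- by move=> u i; rewrite !mxE.
- exact: continuous_submxrow_rsubmx.
Qed.

Let overlap_open (M : topologicalType) n (c d : chart R M n) :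
  open [set u | chart_cod c u /\ chart_dom d (chart_inv c u)].
Proof.
rewrite openE => u [cu du].
have n1 : nbhs u (chart_cod c).
  by apply: open_nbhs_nbhs; split=> //; exact: chart_cod_open.
have n2 : nbhs u [set v | chart_dom d (chart_inv c v)].
  apply: chart_inv_continuous => //.
  by apply: open_nbhs_nbhs; split=> //; exact: chart_dom_open.
exact: filterI n1 n2.
Qed.

Fact prod_atlas_compatible e e' : prod_atlas e -> prod_atlas e' ->
  forall i, Cinf [set u | chart_cod e u /\ chart_dom e' (chart_inv e u)]
                 (fun u => chart_map e' (chart_inv e u) 0 i).
Proof.
move=> [c [d [Ac Ad ->]]] [c' [d' [Ac' Ad' ->]]] i k.
case: (split_ordP i) => h -> /=.
  rewrite (_ : (fun _ => _) =
      (fun u => chart_map c' (chart_inv c (lsubmx u)) 0 h)); last first.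
    by apply/funext => u; rewrite row_mxEl.
  have H := @Cinf_lsub _ (\sum_j dim (F j)) _ _ (@overlap_open _ _ c c')
    (atlas_compatible Ac Ac' h) k.
  apply: sub_Ck H => u [[u1 _] [u2 _]].
  by split.
pose j := tagnat.sig1 h.
rewrite (_ : (fun _ => _) = (fun u => chart_map (d' j)
    (chart_inv (d j) (submxrow (rsubmx u) j)) 0 (tagnat.sig2 h))); last first.
  by apply/funext => u; rewrite row_mxEr mxE.
have H := @Cinf_rsub (dim B) (fun j => dim (F j)) j _ _ (@overlap_open _ _ (d j) (d' j))
  (atlas_compatible (Ad j) (Ad' j) (tagnat.sig2 h)) k.
apply: sub_Ck H => u [[_ u1] [_ u2]].
by split; [exact: u1|exact: u2].
Qed.

Definition prod_manifold : manifold R := @Manifold R space _ prod_atlas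
  (hausdorff_prod (@manifold_hausdorff R B)
    (fun j => @manifold_hausdorff R (F j)))
  (second_countable_prod (@manifold_second_countable R B)
    (fun j => @manifold_second_countable R (F j)))
  prod_atlas_cover prod_atlas_compatible.

Definition proj_base (x : prod_manifold) : B := x.1.

Definition proj_fiber j (x : prod_manifold) : F j := x.2 j.

Lemma proj_base_smooth f :
  f \in smooth B -> f \o proj_base \in smooth prod_manifold.
Proof.
move=> /smoothP sf; apply/smoothP => _ [c [d [Ac _ ->]]] k.
have H := @Cinf_lsub _ (\sum_j dim (F j)) _ _ (@chart_cod_open _ _ _ c)
  (sf c Ac) k.
apply: sub_Ck H.
by move=> u [].
Qed.

Lemma proj_fiber_smooth j f :
  f \in smooth (F j) -> f \o @proj_fiber j \in smooth prod_manifold.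
Proof.
move=> /smoothP sf; apply/smoothP => _ [c [d [_ Ad ->]]] k.
have H := @Cinf_rsub (dim B) (fun j => dim (F j)) j _ _ (@chart_cod_open _ _ _ (d j))
  (sf _ (Ad j)) k.
apply: sub_Ck H.
by move=> u [_ /(_ j)].
Qed.

End ProductManifold.

Section WarpedProduct.
Context {R : realType} {l : nat} {B : manifold R} {F : 'I_l -> manifold R}.

Let M := prod_manifold B F.

Definition d_base (x : M) (v : tangent x) : tangent (proj_base x) :=
  differential (@proj_base_smooth R l B F) v.

Definition d_fiber j (x : M) (v : tangent x) : tangent (proj_fiber j x) :=
  differential (@proj_fiber_smooth R l B F j) v.

(* The lift of X is the vector field that is related to X by the projection on B
   and to 0 by the projections on the fibers; likewise for the lift of a vector
   field on the j-th fiber. A tangent vector of the product is determined by its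
   projections, so there is at most one lift. *)
Definition base_lift (X : vector_field B) (X' : vector_field M) : Prop :=
  forall x : M, d_base (X' x) = X (proj_base x) /\
    forall j, d_fiber j (X' x) = 0.

Definition fiber_lift j (V : vector_field (F j)) (V' : vector_field M) : Prop :=
  forall x : M, [/\ d_base (V' x) = 0, d_fiber j (V' x) = V (proj_fiber j x)
    & forall i, i != j -> d_fiber i (V' x) = 0].

Section Form.
Variables (gB : singular_metric B) (f : 'I_l -> smooth_fun B).
Variables (gF : forall j, singular_metric (F j)).

Definition warped_form (x : M) (v w : tangent x) : R :=
  gB (proj_base x) (d_base v) (d_base w) +
  \sum_(j < l) f j (proj_base x) ^+ 2 *
    gF j (proj_fiber j x) (d_fiber j v) (d_fiber j w).

Fact warped_form_bilinear x : bilinear_for *%R *%R (@warped_form x).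
Proof.
split=> [w a v v'|v a w w']; rewrite /warped_form /d_base /d_fiber.
  rewrite linearP linearPl /= mulrDr [RHS]addrACA; congr (_ + _).
  rewrite mulr_sumr -big_split /=; apply: eq_bigr => j _.
  by rewrite linearP linearPl /= mulrDr mulrCA.
rewrite linearP linearPr /= mulrDr [RHS]addrACA; congr (_ + _).
rewrite mulr_sumr -big_split /=; apply: eq_bigr => j _.
by rewrite linearP linearPr /= mulrDr mulrCA.
Qed.

HB.instance Definition _ x := bilinear_isBilinear.Build R _ _ _ _ _
  (@warped_form x) (warped_form_bilinear x).

Definition warped_metric (x : M) : {biscalar (tangent x)} := @warped_form x.

End Form.
End WarpedProduct.

(* Main.v *)
(* A lift of a vector field on B or on F_j is a field projecting to a field
   (X_0, X_1, ..., X_l) on each factor, with all but one of the X_i equal to 0.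
   Fields projecting to the factors are closed under brackets, and the metric
   depends on the projections only, so the Leibniz rule gives, for such fields
   X, Y, Z,
     K(X,Y,Z) = K_B(X_0,Y_0,Z_0) + sum_j f_j^2 K_{F_j}(X_j,Y_j,Z_j)
       + sum_j f_j (X_0(f_j) g_{F_j}(Y_j,Z_j) + Y_0(f_j) g_{F_j}(Z_j,X_j)
                    - Z_0(f_j) g_{F_j}(X_j,Y_j)).
   All the identities are obtained by setting components to 0. *)
From HB Require Import structures.
Require Import Defs.
From mathcomp Require Import all_boot all_order all_algebra.
From mathcomp Require Import all_classical all_reals all_analysis.
From mathcomp Require Import ring.

Import Order.TTheory GRing.Theory Num.Theory.
Local Open Scope ring_scope.

Set Implicit Arguments.
Unset Strict Implicit.
Unset Printing Implicit Defensive.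

(** * Tangent vectors as linear forms, and Koszul forms with a zero argument *)

Section Tangent.
Context {R : realType} {M : manifold R}.

Fact tangent_is_scalar (p : M) (v : tangent p) : scalar v.
Proof. by have /derivation_atP[] := tangent_derivation v. Qed.

HB.instance Definition _ (p : M) (v : tangent p) :=
  GRing.isLinear.Build R (smooth_fun M) R _ (tangent_val v)
    (tangent_is_scalar v).

Lemma tangentM (p : M) (v : tangent p) (f g : smooth_fun M) :
  v (f * g) = v f * g p + f p * v g.
Proof. by have /derivation_atP[_ ->] := tangent_derivation v. Qed.

Lemma tangentP (p : M) (v w : tangent p) : (forall h, v h = w h) -> v = w.
Proof. by move=> vw; apply/val_inj/funext. Qed.

Fact vf0_subproof (h : smooth_fun M) :
  (fun p : M => (0 : tangent p) h) \in smooth M.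
Proof. exact: smooth_cst. Qed.

(** The component of a lift along every factor other than its own. *)
Definition vf0 : vector_field M := VectorField vf0_subproof.

Lemma vf0E p : vf0 p = 0.
Proof. by []. Qed.

Lemma vf0_appE p h : vf0 p h = 0.
Proof. by []. Qed.

Lemma smooth_mulE (h k : smooth_fun M) p : (h * k) p = h p * k p.
Proof. by []. Qed.

Lemma smooth_sumE I (r : seq I) (P : pred I) (G : I -> smooth_fun M) p :
  (\sum_(i <- r | P i) G i) p = \sum_(i <- r | P i) G i p.
Proof. by elim/big_rec2: _ => // i y z _ <-. Qed.

Lemma bracketE (X Y : vector_field M) p h :
  bracket X Y p h = X p (vf_app Y h) - Y p (vf_app X h).
Proof. by []. Qed.

Lemma vf_app0 h : vf_app vf0 h = 0.
Proof. exact/val_inj. Qed.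

Lemma bracket0l X p : bracket vf0 X p = 0.
Proof. by apply: tangentP => h; rewrite bracketE vf_app0 raddf0 subr0. Qed.

Lemma bracket0r X p : bracket X vf0 p = 0.
Proof.
by apply: tangentP => h; rewrite bracketE vf_app0 raddf0 sub0r oppr0.
Qed.

(** No smoothness of [h] is needed: the zero derivation and the default value of [vf_derive] are
    both 0. *)
Lemma vf_derive0 (h : M -> R) p : vf_derive vf0 h p = 0.
Proof. by rewrite /vf_derive; case: insub. Qed.

Lemma vf_deriveE (X : vector_field M) (h : smooth_fun M) p :
  vf_derive X h p = X p h.
Proof. by rewrite /vf_derive valK. Qed.

Section Zero.
Variable g : forall p : M, {biscalar (tangent p)}.
Implicit Types X Y : vector_field M.

(** The right-hand side is the coercion of a smooth function, so that [vf_deriveE] applies after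
    rewriting. *)
Lemma inner0l X : inner g vf0 X = (0 : smooth_fun M).
Proof. by apply/funext => p; rewrite /inner vf0E linear0l. Qed.

Lemma inner0r X : inner g X vf0 = (0 : smooth_fun M).
Proof. by apply/funext => p; rewrite /inner vf0E linear0r. Qed.

Lemma inner0 X p : (inner g vf0 X p = 0) * (inner g X vf0 p = 0).
Proof. by rewrite inner0l inner0r. Qed.

Lemma inner_bracket0 X Y p :
  (inner g X (bracket vf0 Y) p = 0) * (inner g X (bracket Y vf0) p = 0).
Proof. by rewrite /inner bracket0l bracket0r !linear0r. Qed.

(** The zero field occurs in each of the six terms: as direction of derivation, as argument of the
    inner product, or inside the bracket. *)
Lemma koszul0 X Y p :
  (koszul g vf0 X Y p = 0) * (koszul g X vf0 Y p = 0) *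
  (koszul g X Y vf0 p = 0).
Proof.
rewrite /koszul !inner_bracket0 !inner0 !(inner0l, inner0r) !vf_deriveE.
by rewrite !vf_derive0 !raddf0 !(oppr0, addr0, mulr0).
Qed.

End Zero.

Variable g : singular_metric M.

Definition smooth_inner (X Y : vector_field M) : smooth_fun M :=
  SmoothFun (metric_smooth g X Y).

Lemma innerC (X Y : vector_field M) p : inner g X Y p = inner g Y X p.
Proof. exact: Defs.metric_sym. Qed.

Lemma vf_derive_inner (X Y Z : vector_field M) p :
  vf_derive X (inner g Y Z) p = X p (smooth_inner Y Z).
Proof. exact: (vf_deriveE X (smooth_inner Y Z)). Qed.

End Tangent.

(** * Fields on the product that project to every factor *)

Section WarpedKoszul.
Context {R : realType} {l : nat} {B : manifold R} {F : 'I_l -> manifold R}.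
Local Notation M := (prod_manifold B F).

Definition base_fun (h : smooth_fun B) : smooth_fun M :=
  pullback (@proj_base_smooth R l B F) h.

Definition fiber_fun j (h : smooth_fun (F j)) : smooth_fun M :=
  pullback (@proj_fiber_smooth R l B F j) h.

(** Common generalization of [base_lift] and [fiber_lift], so that a single formula serves all the
    identities. *)
Definition lift (X : vector_field B) (XF : forall j, vector_field (F j))
    (X' : vector_field M) : Prop :=
  forall x : M, d_base (X' x) = X (proj_base x) /\
    forall j, d_fiber j (X' x) = XF j (proj_fiber j x).

(** Taking the whole family [V] instead of [V j] avoids a cast from [vector_field (F j)] to
    [vector_field (F i)]. *)
Definition single (V : forall j, vector_field (F j)) j :
    forall i, vector_field (F i) := fun i => if i == j then V i else vf0.

Lemma single_eq V j : single V j j = V j.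
Proof. by rewrite /single eqxx. Qed.

Lemma single_neq V i j : (i == j) = false -> single V j i = vf0.
Proof. by rewrite /single => ->. Qed.

Lemma base_liftP X X' : base_lift X X' -> lift X (fun=> vf0) X'.
Proof. by []. Qed.

Lemma fiber_liftP V j V' : fiber_lift (V j) V' -> lift vf0 (single V j) V'.
Proof.
move=> h x; have [hb hj hi] := h x; split=> // i.
have [->|ij] := eqVneq i j; first by rewrite single_eq.
by rewrite hi // (single_neq V (negPf ij)).
Qed.

Section Lift.
Variables (X : vector_field B) (XF : forall j, vector_field (F j)).
Variables (X' : vector_field M) (hX : lift X XF X').

(** The differential of a projection is, by definition, the action on pulled back functions. *)
Lemma lift_base x h : X' x (base_fun h) = X (proj_base x) h.
Proof. by have [<-] := hX x. Qed.

Lemma lift_fiber j x (h : smooth_fun (F j)) :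
  X' x (fiber_fun h) = XF j (proj_fiber j x) h.
Proof. by have [_ <-] := hX x. Qed.

(** A pullback stays a pullback under a lift, hence second derivatives, and so brackets, can be
    computed on the factor. *)
Lemma vf_app_base h : vf_app X' (base_fun h) = base_fun (vf_app X h).
Proof. by apply/val_inj/funext => x; rewrite /= lift_base. Qed.

Lemma vf_app_fiber j (h : smooth_fun (F j)) :
  vf_app X' (fiber_fun h) = fiber_fun (vf_app (XF j) h).
Proof. by apply/val_inj/funext => x; rewrite /= lift_fiber. Qed.

End Lift.

(** Brackets of fields related by a smooth map are related; this is applied to each projection. *)
Lemma lift_bracket X XF X' Y YF Y' : lift X XF X' -> lift Y YF Y' ->
  lift (bracket X Y) (fun j => bracket (XF j) (YF j)) (bracket X' Y').
Proof.
move=> hX hY x; split=> [|j]; apply: tangentP => h.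
  rewrite -[LHS]/(bracket X' Y' x (base_fun h)) !bracketE.
  by rewrite (vf_app_base hX) (vf_app_base hY) (lift_base hX) (lift_base hY).
rewrite -[LHS]/(bracket X' Y' x (fiber_fun h)) !bracketE.
rewrite (vf_app_fiber hX) (vf_app_fiber hY).
by rewrite (lift_fiber hX) (lift_fiber hY).
Qed.

(** * The Koszul form of the warped metric on such fields *)

Variables (gB : singular_metric B) (f : 'I_l -> smooth_fun B).
Variable gF : forall j, singular_metric (F j).
Local Notation g := (warped_metric gB f gF).

Lemma inner_lift X XF X' Y YF Y' x : lift X XF X' -> lift Y YF Y' ->
  inner g X' Y' x = inner gB X Y (proj_base x) +
    \sum_(j < l) f j (proj_base x) ^+ 2 *
      inner (gF j) (XF j) (YF j) (proj_fiber j x).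
Proof.
move=> hX hY; have [bX fX] := hX x; have [bY fY] := hY x.
rewrite /inner /warped_metric /= /warped_form bX bY; congr (_ + _).
by apply: eq_bigr => j _; rewrite fX fY.
Qed.

Lemma derive_inner_lift X XF X' Y YF Y' Z ZF Z' x :
  lift X XF X' -> lift Y YF Y' -> lift Z ZF Z' ->
  vf_derive X' (inner g Y' Z') x =
    vf_derive X (inner gB Y Z) (proj_base x) +
    \sum_(j < l) (f j (proj_base x) ^+ 2 *
        vf_derive (XF j) (inner (gF j) (YF j) (ZF j)) (proj_fiber j x) +
      2 * f j (proj_base x) * vf_app X (f j) (proj_base x) *
        inner (gF j) (YF j) (ZF j) (proj_fiber j x)).
Proof.
move=> hX hY hZ.
(* The inner product is exhibited as an element of the algebra of smooth functions, with the square
   as a product, so that the Leibniz rule [tangentM] applies. *)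
have -> : inner g Y' Z' = (base_fun (smooth_inner gB Y Z) +
    \sum_(j < l) base_fun (f j) * base_fun (f j) *
      fiber_fun (smooth_inner (gF j) (YF j) (ZF j)) : smooth_fun M).
  apply/funext => y; rewrite (inner_lift y hY hZ).
  rewrite -[RHS]/(_ + (\sum_(j < l) _ : smooth_fun M) y) smooth_sumE.
  by congr (_ + _); apply: eq_bigr => j _; rewrite expr2.
rewrite vf_deriveE raddfD raddf_sum /= (lift_base hX) vf_derive_inner.
congr (_ + _); apply: eq_bigr => j _.
rewrite !tangentM !(lift_base hX) (lift_fiber hX) vf_derive_inner.
by rewrite smooth_mulE /inner /=; ring.
Qed.

(** Derivatives of the warping functions come only from the three derivative terms; their factor 2
    cancels the one half of the Koszul form. *)
Lemma koszul_lift X XF X' Y YF Y' Z ZF Z' x :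
  lift X XF X' -> lift Y YF Y' -> lift Z ZF Z' ->
  let b := proj_base x in
  koszul g X' Y' Z' x = koszul gB X Y Z b +
    \sum_(j < l) (f j b ^+ 2 *
        koszul (gF j) (XF j) (YF j) (ZF j) (proj_fiber j x) +
      f j b * (X b (f j) * inner (gF j) (YF j) (ZF j) (proj_fiber j x) +
               Y b (f j) * inner (gF j) (ZF j) (XF j) (proj_fiber j x) -
               Z b (f j) * inner (gF j) (XF j) (YF j) (proj_fiber j x))).
Proof.
move=> hX hY hZ b; rewrite /koszul.
rewrite (derive_inner_lift x hX hY hZ) (derive_inner_lift x hY hZ hX).
rewrite (derive_inner_lift x hZ hX hY).
rewrite (inner_lift x hX (lift_bracket hY hZ)).
rewrite (inner_lift x hY (lift_bracket hZ hX)).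
rewrite (inner_lift x hZ (lift_bracket hX hY)) -/b.
set s1 := \sum_j _; set s2 := \sum_j _; set s3 := \sum_j _.
set s4 := \sum_j _; set s5 := \sum_j _; set s6 := \sum_j _.
transitivity (koszul gB X Y Z b + 2^-1 * (s1 + s2 - s3 - s4 + s5 + s6)).
  (* Base contributions are split off; the fiber sums are then compared index by index. *)
  by rewrite /koszul; ring.
congr (_ + _); rewrite {}/s1 {}/s2 {}/s3 {}/s4 {}/s5 {}/s6.
rewrite -big_split -!sumrB -!big_split mulr_sumr.
by apply: eq_bigr => j _; rewrite /vf_app /=; field.
Qed.

End WarpedKoszul.

Theorem proposition5p2 (R : realType) (l : nat)
    (B : manifold R) (F : 'I_l -> manifold R)
    (gB : singular_metric B) (gF : forall j, singular_metric (F j))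
    (f : 'I_l -> smooth_fun B)
    (X Y Z : vector_field B) (U V W : forall j, vector_field (F j))
    (X' Y' Z' : vector_field (prod_manifold B F))
    (U' V' W' : 'I_l -> vector_field (prod_manifold B F))
    (hX : base_lift X X') (hY : base_lift Y Y') (hZ : base_lift Z Z')
    (hU : forall j, fiber_lift (U j) (U' j))
    (hV : forall j, fiber_lift (V j) (V' j))
    (hW : forall j, fiber_lift (W j) (W' j)) :
  let K := koszul (warped_metric gB f gF) in
  (forall x, K X' Y' Z' x = koszul gB X Y Z (proj_base x)) /\
  (forall j x,
     [/\ K X' Y' (W' j) x = 0, K X' (W' j) Y' x = 0
       & K (W' j) X' Y' x = 0]) /\
  (forall j x,
     let c := f j (proj_base x)
              * inner (gF j) (V j) (W j) (proj_fiber j x)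
              * vf_app X (f j) (proj_base x) in
     [/\ K X' (V' j) (W' j) x = c, K (V' j) X' (W' j) x = c
       & - K (V' j) (W' j) X' x = c]) /\
  (forall i j x, i != j ->
     [/\ K X' (V' i) (W' j) x = 0, K (V' i) X' (W' j) x = 0
       & K (V' i) (W' j) X' x = 0]) /\
  (forall j x,
     K (U' j) (V' j) (W' j) x =
     f j (proj_base x) ^+ 2
     * koszul (gF j) (U j) (V j) (W j) (proj_fiber j x)) /\
  (forall i j k x, i != j -> j != k -> i != k ->
     K (U' i) (V' j) (W' k) x = 0) /\
  (forall i j x, i != j ->
     [/\ K (U' i) (V' i) (W' j) x = 0, K (U' i) (W' j) (V' i) x = 0
       & K (W' j) (U' i) (V' i) x = 0]).
Proof.
have sX := base_liftP hX; have sY := base_liftP hY; have sZ := base_liftP hZ.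
have sU j := fiber_liftP (hU j); have sV j := fiber_liftP (hV j).
have sW j := fiber_liftP (hW j).
(* Left generic in the manifold, these rules serve the base and all the fibers. *)
pose zeroE := (@koszul0 R, @inner0 R, @vf0_appE R).
pose simpE := (mulr0, mul0r, addr0, add0r, subr0, sub0r, oppr0).
move=> K; split; [|split; [|split; [|split; [|split; [|split]]]]].
- move=> x; rewrite /K (koszul_lift _ _ _ x sX sY sZ) big1 ?addr0 // => k _.
  by rewrite !zeroE !simpE.
- move=> j x; rewrite /K (koszul_lift _ _ _ x sX sY (sW j)).
  rewrite (koszul_lift _ _ _ x sX (sW j) sY).
  rewrite (koszul_lift _ _ _ x (sW j) sX sY) !koszul0.
  by split; rewrite big1 ?addr0 // => k _; rewrite !zeroE !simpE.
- move=> j x c; rewrite /K (koszul_lift _ _ _ x sX (sV j) (sW j)).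
  rewrite (koszul_lift _ _ _ x (sV j) sX (sW j)).
  rewrite (koszul_lift _ _ _ x (sV j) (sW j) sX) !koszul0.
  (* Only index [j] contributes; there [koszul] has a zero argument, and one term with a derivative
     of [f j] survives. *)
  split; (rewrite (bigD1 j) // big1 => [|k /negPf kj];
    [rewrite !single_eq | rewrite !(single_neq _ kj)]);
    rewrite !zeroE !simpE //=.
  + by rewrite addr0 (mulrC (X _ _)) mulrA.
  (* The surviving inner product is cyclically ordered, with [W j] before [V j]. *)
  + by rewrite addr0 innerC (mulrC (X _ _)) mulrA.
  + by rewrite addr0 mulrN opprK (mulrC (X _ _)) mulrA.
- move=> i j x ij; rewrite /K (koszul_lift _ _ _ x sX (sV i) (sW j)).
  rewrite (koszul_lift _ _ _ x (sV i) sX (sW j)).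
  rewrite (koszul_lift _ _ _ x (sV i) (sW j) sX) !koszul0.
  (* At index [i] the component of [W' j] is zero; at any other index that of [V' i] is. *)
  by split; (rewrite big1 ?addr0 // => k _; have [->|/negPf ki] := eqVneq k i;
    [rewrite !(single_neq _ (negPf ij)) | rewrite !(single_neq _ ki)]);
    rewrite !zeroE !simpE.
(* All base components are zero, so no derivative of a warping function remains. *)
- move=> j x; rewrite /K (koszul_lift _ _ _ x (sU j) (sV j) (sW j)) koszul0.
  by rewrite (bigD1 j) // big1 => [|k /negPf kj];
    [rewrite !single_eq | rewrite !(single_neq _ kj)];
    rewrite !zeroE !simpE /= ?addr0.
- move=> i j k x ij jk ik.
  rewrite /K (koszul_lift _ _ _ x (sU i) (sV j) (sW k)) koszul0.
  (* At index [i] the component of [V' j] is zero; elsewhere that of [U' i] is. *)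
  rewrite big1 ?addr0 // => m _; have [->|/negPf mi] := eqVneq m i.
    by rewrite !(single_neq _ (negPf ij)) !zeroE !simpE.
  by rewrite !(single_neq _ mi) !zeroE !simpE.
- move=> i j x ij; rewrite /K (koszul_lift _ _ _ x (sU i) (sV i) (sW j)).
  rewrite (koszul_lift _ _ _ x (sU i) (sW j) (sV i)).
  rewrite (koszul_lift _ _ _ x (sW j) (sU i) (sV i)) !koszul0.
  by split; (rewrite big1 ?addr0 // => k _; have [->|/negPf ki] := eqVneq k i;
    [rewrite !(single_neq _ (negPf ij)) | rewrite !(single_neq _ ki)]);
    rewrite !zeroE !simpE.
Qed.
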